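(* Let $m\in\mathbb{N}$ with $m \geq 2$. Then $$P^*_{DP}(K_4,m) = \begin{cases} m^4 - 6m^3 + 15m^2 - 13m & \text{if } m \text{ is even} \\ m^4 - 6m^3 + 15m^2 - 13m-3 & \text{if } m \text{ is odd.} \end{cases}$$ Consequently, there is no $N \in \mathbb{N}$ and polynomial $p(m)$ such that $P_{DP}^*(K_4,m) = p(m)$ for all integers $m \geq N$.
   Context: All graphs are nonempty, finite and simple; $\mathbb{N}=\{1,2,3,\ldots\}$; $K_4$ is the complete graph on 4 vertices. For a graph $H$ and $A,B\subseteq V(H)$, $E_H(A,B)$ is the set of edges of $H$ with one endpoint in $A$ and the other in $B$. A (DP-)cover of a graph $G$ is a pair $\mathcal{H}=(L,H)$, where $H$ is a graph and $L:V(G)\to 2^{V(H)}$ is a function such that: (1) $\{L(v):v\in V(G)\}$ is a partition of $V(H)$ into $|V(G)|$ parts; (2) for every pair of adjacent vertices $u,v\in V(G)$, the edges in $E_H(L(u),L(v))$ form a (possibly empty) matching; (3) $E(H)=\bigcup_{uv\in E(G)}E_H(L(u),L(v))$. It is an $m$-fold cover if $|L(v)|=m$ for all $v\in V(G)$, and an $m$-fold cover is full if $|E_H(L(u),L(v))|=m$ for each $uv\in E(G)$. A transversal of $\mathcal{H}$ is a set $T\subseteq V(H)$ containing exactly one vertex of $L(v)$ for each $v\in V(G)$; it is a proper $\mathcal{H}$-coloring of $G$ if it is an independent set in $H$. $P_{DP}(G,\mathcal{H})$ denotes the number of proper $\mathcal{H}$-colorings of $G$. The dual DP color function $P^*_{DP}(G,m)$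 is the maximum of $P_{DP}(G,\mathcal{H})$ over all full $m$-fold covers $\mathcal{H}$ of $G$. *)

(* Defs.v *)
From HB Require Import structures.
From mathcomp Require Import all_boot all_order all_algebra.
From mathcomp Require Import boolp.
From mathcomp Require classical_sets.

Set Implicit Arguments.
Unset Strict Implicit.
Unset Printing Implicit Defensive.

Import Order.TTheory GRing.Theory Num.Theory.

Local Open Scope nat_scope.

Record sgraph := SGraph {
  vertex :> finType;
  edge : rel vertex;
  edge_sym : symmetric edge;
  edge_irrefl : irreflexive edge;
  vertex_gt0 : 0 < #|vertex| }.

(* Edges are unordered, i.e., two-element vertex sets [set x; y]. *)
Definition edges_between (H : sgraph) (A B : {set H}) : {set {set H}} :=
  [set [set x; y] | x in A, y in B & edge x y].

Definition edges (H : sgraph) : {set {set H}} :=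
  edges_between [set: H] [set: H].

(* A set of edges is a matching when distinct members share no endpoint. *)
Definition matching (H : sgraph) (M : {set {set H}}) : bool := trivIset M.

Definition independent (H : sgraph) (T : {set H}) : bool :=
  [forall x in T, forall y in T, ~~ edge x y].

Record cover (G : sgraph) := Cover {
  cgraph : sgraph;
  clist : G -> {set cgraph};
  clist_partition :
    partition [set clist v | v : G] [set: cgraph];
  clist_card : #|[set clist v | v : G]| = #|G|;
  cover_matching : forall u v : G, edge u v ->
    matching (edges_between (clist u) (clist v));
  cover_edges : edges cgraph =
    (\bigcup_(uv : G * G | edge uv.1 uv.2)
       edges_between (clist uv.1) (clist uv.2)) }.

Definition fold_cover (G : sgraph) (m : nat) (C : cover G) : Prop :=
  forall v : G, #|clist C v| = m.

Definition full_cover (G : sgraph) (m : nat) (C : cover G) : Prop :=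
  fold_cover m C /\
  forall u v : G, edge u v -> #|edges_between (clist C u) (clist C v)| = m.

Definition transversal_of (G : sgraph) (C : cover G)
    (T : {set cgraph C}) : bool :=
  [forall v : G, #|T :&: clist C v| == 1].

Definition PDP (G : sgraph) (C : cover G) : nat :=
  #|[set T : {set cgraph C} | transversal_of T && independent T]|.

Definition is_max_PDP (G : sgraph) (m k : nat) : Prop :=
  (exists2 C : cover G, full_cover m C & PDP C = k) /\
  (forall C : cover G, full_cover m C -> PDP C <= k).

(* The default value 0 is only used for m = 0, see [dual_PDPP]. *)
Definition dual_PDP (G : sgraph) (m : nat) : nat :=
  classical_sets.xget 0 (is_max_PDP G m).

Section WellDefined.

Variable G : sgraph.
Variable n : nat.
Let m := n.+1.

Definition prod_edge : rel (G * 'I_m) :=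
  fun x y => edge x.1 y.1 && (x.2 == y.2).

Fact prod_edge_sym : symmetric prod_edge.
Proof. by move=> x y; rewrite /prod_edge edge_sym eq_sym. Qed.

Fact prod_edge_irrefl : irreflexive prod_edge.
Proof. by move=> x; rewrite /prod_edge edge_irrefl. Qed.

Fact prod_gt0 : 0 < #|{: G * 'I_m}|.
Proof. by rewrite card_prod card_ord muln_gt0 vertex_gt0. Qed.

Definition prod_graph : sgraph :=
  SGraph prod_edge_sym prod_edge_irrefl prod_gt0.

Definition prod_list (v : G) : {set prod_graph} :=
  [set x : prod_graph | x.1 == v].

Fact in_prod_list v (x : prod_graph) : (x \in prod_list v) = (x.1 == v).
Proof. by rewrite inE. Qed.

Fact prod_list_inj : injective prod_list.
Proof.
move=> u v /setP /(_ ((u, ord0) : prod_graph)).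
by rewrite !in_prod_list eqxx => /esym/eqP.
Qed.

Fact prod_partition :
  partition [set prod_list v | v : G] [set: prod_graph].
Proof.
apply/and3P; split.
- apply/eqP/setP => x; rewrite inE; apply/bigcupP.
  exists (prod_list x.1); first exact: imset_f.
  by rewrite in_prod_list.
- apply/trivIsetP => _ _ /imsetP[u _ ->] /imsetP[v _ ->] uv.
  rewrite -setI_eq0; apply/eqP/setP => x; rewrite in_setI !in_prod_list in_set0.
  apply/negbTE/negP => /andP[/eqP xu /eqP xv].
  by move: uv; rewrite -xu -xv eqxx.
- apply/negP => /imsetP[v _ /setP /(_ ((v, ord0) : prod_graph))].
  by rewrite in_prod_list in_set0 eqxx.
Qed.

Fact prod_card : #|[set prod_list v | v : G]| = #|G|.
Proof. by rewrite card_imset //; exact: prod_list_inj. Qed.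

Fact prod_between (u v : G) : edge u v ->
  edges_between (prod_list u) (prod_list v) =
  [set [set ((u, i) : prod_graph); ((v, i) : prod_graph)] | i : 'I_m].
Proof.
move=> uv; apply/setP => e; apply/imset2P/imsetP.
- move=> [[x1 x2] [y1 y2]]; rewrite in_prod_list => /eqP /= ->.
  rewrite inE in_prod_list /= => /andP[/eqP -> /andP[_ /eqP /= ->]] ->.
  by exists y2.
- move=> [i _ ->].
  exists ((u, i) : prod_graph) ((v, i) : prod_graph) => //.
    by rewrite in_prod_list.
  by rewrite inE in_prod_list /= eqxx /edge /= /prod_edge /= uv eqxx.
Qed.

Fact prod_mem_between (u v : G) i j (x : prod_graph) :
  x \in [set ((u, i) : prod_graph); ((v, i) : prod_graph)] ->
  x \in [set ((u, j) : prod_graph); ((v, j) : prod_graph)] -> i = j.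
Proof. by move=> /set2P[] -> /set2P[] []. Qed.

Fact prod_matching (u v : G) : edge u v ->
  matching (edges_between (prod_list u) (prod_list v)).
Proof.
move=> uv; rewrite prod_between //.
apply/trivIsetP => _ _ /imsetP[i _ ->] /imsetP[j _ ->] ij.
rewrite -setI_eq0; apply/eqP/setP => x; rewrite in_setI in_set0.
apply/negbTE/negP => /andP[xi xj].
by move: ij; rewrite (prod_mem_between xi xj) eqxx.
Qed.

Fact prod_edges : edges prod_graph =
  (\bigcup_(uv : G * G | edge uv.1 uv.2)
     edges_between (prod_list uv.1) (prod_list uv.2)).
Proof.
apply/setP => e; apply/imset2P/bigcupP.
- move=> [x y _]; rewrite !inE => /= xy ->.
  exists (x.1, y.1); first by case/andP: xy.
  apply/imset2P; exists x y => //; first by rewrite in_prod_list.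
  by rewrite inE in_prod_list eqxx.
- move=> [[u v] /= uv] /imset2P[x y _]; rewrite inE => /andP[_ xy] ->.
  by exists x y => //; rewrite !inE.
Qed.

Definition prod_cover : cover G :=
  Cover prod_partition prod_card prod_matching prod_edges.

Fact prod_cover_full : full_cover m prod_cover.
Proof.
split=> [v | u v uv] /=.
- have -> : prod_list v =
      [set ((v, i) : prod_graph) | i : 'I_m].
    apply/setP => -[w i]; rewrite in_prod_list /=; apply/eqP/imsetP.
      by move=> ->; exists i.
    by move=> [j _ []].
  by rewrite card_imset ?card_ord // => i j [].
- rewrite prod_between // card_imset ?card_ord // => i j eij.
  by apply: (@prod_mem_between u v i j ((u, i) : prod_graph));
    rewrite -?eij set21.
Qed.

Fact PDP_bounded (C : cover G) : full_cover m C -> PDP C <= 2 ^ (#|G| * m).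
Proof.
move=> [Cm _].
have <- : #|cgraph C| = #|G| * m.
  rewrite -cardsT -(clist_card C); apply: card_uniform_partition.
    by move=> _ /imsetP[v _ ->]; exact: Cm.
  exact: clist_partition.
rewrite -cardsT -card_powerset; apply: subset_leq_card.
by apply/subsetP => T _; rewrite powersetE subsetT.
Qed.

Fact max_PDP_exists : exists k, is_max_PDP G m k.
Proof.
pose P := fun k => `[< exists2 C : cover G, full_cover m C & PDP C = k >].
have exP : exists k, P k.
  exists (PDP prod_cover); apply/asboolP.
  by exists prod_cover => //; exact: prod_cover_full.
have ubP k : P k -> k <= 2 ^ (#|G| * m).
  by move=> /asboolP[C Cf <-]; exact: PDP_bounded.
case: (ex_maxnP exP ubP) => k /asboolP Pk maxk.
by exists k; split=> // C Cf; apply: maxk; apply/asboolP; exists C.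
Qed.

End WellDefined.

Lemma dual_PDPP (G : sgraph) (m : nat) :
  0 < m -> is_max_PDP G m (dual_PDP G m).
Proof.
by case: m => // n _; have [k kP] := max_PDP_exists G n; exact: (classical_sets.xgetI 0 kP).
Qed.

Fact neq_sym (T : eqType) : symmetric (fun x y : T => x != y).
Proof. by move=> x y; rewrite eq_sym. Qed.

Fact neq_irrefl (T : eqType) : irreflexive (fun x y : T => x != y).
Proof. by move=> x; rewrite eqxx. Qed.

Fact ord4_gt0 : 0 < #|'I_4|.
Proof. by rewrite card_ord. Qed.

Definition K4 : sgraph :=
  SGraph (@neq_sym 'I_4) (@neq_irrefl 'I_4) ord4_gt0.

(* Main.v *)
(* The matchings from L(0) to L(1), L(2), L(3) may be taken to be
   the identity of 'I_m; a full cover is then given by three permutations a, b,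
   c carried by the edges 12, 23, 13. Fixing the colors y, z, w of 1, 2, 3, the
   vertex 0 has m - #{y, z, w} colors left, which yields
     P = (m - 3) (m (m^2 - 3 m + 3) - #{y | b (a y) = c y}) + sum_y term(y).
   For m >= 3 this is at most m^4 - 6 m^3 + 15 m^2 - 13 m minus the defects
   m - #{y | p y = q y} for (p, q) = (b, c), (a^-1, c^-1), (a, b^-1). A nonzero
   defect is at least 2, and if two of them vanish then the third compares some
   p with p^-1, so that it is 0 or at least 3. If all three vanish then
   a = b = c is an involution, which has a fixed point when m is odd, and a
   fixed point costs at least 3 as well. Conversely b = a^-1, c = a reaches the
   bound, with a a fixed-point-free involution (m even) or the product of a
   3-cycle and transpositions (m odd). For m = 2 the upper bound is the greedy
   bound m (m - 1)^3. *)
Require Import Defs.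
From mathcomp Require Import all_boot all_order all_fingroup all_algebra.
From mathcomp Require Import zify ring lra.

Set Implicit Arguments.
Unset Strict Implicit.
Unset Printing Implicit Defensive.

Import Order.TTheory GRing.Theory Num.Theory.
Local Open Scope ring_scope.

(** * Counting colorings of K4 for three given permutations *)

Definition delta (T : eqType) (x y : T) : int := (x == y)%:R.

Lemma deltaC (T : eqType) (x y : T) : delta x y = delta y x.
Proof. by rewrite /delta eq_sym. Qed.

Section Counting.
Variable T : finType.
Implicit Types (x y z w : T) (a b c p q : {perm T}).

Let m : int := #|T|%:Z.

Lemma sum_delta_mul y (F : T -> int) : \sum_x delta x y * F x = F y.
Proof.
rewrite (bigD1 y) //= big1 ?addr0 /delta ?eqxx ?mul1r // => x /negbTE ->.
by rewrite mul0r.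
Qed.

Lemma sum_delta y : \sum_x delta x y = 1.
Proof.
by rewrite -[RHS](sum_delta_mul y (fun=> 1)); apply: eq_bigr => x _; rewrite mulr1.
Qed.

Lemma sum_const_card (k : int) : \sum_(x : T) k = m * k.
Proof. by rewrite sumr_const -mulr_natl natz. Qed.

Lemma sum_avoid2 y z :
  \sum_x (1 - delta x y) * (1 - delta x z) = m - 2 + delta y z.
Proof.
transitivity (\sum_x (1 - delta x y - delta x z + delta x y * delta x z)).
  by apply: eq_bigr => x _; ring.
rewrite !big_split /= !sumrN !sum_delta sum_delta_mul sum_const_card.
ring.
Qed.

(** The right side is m minus the number of distinct values among y, z, w; the product corrects the
    case where all three coincide. *)
Lemma sum_avoid3 y z w :
  \sum_x (1 - delta x y) * (1 - delta x z) * (1 - delta x w) =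
  m - 3 + delta y z + delta z w + delta y w - delta y z * delta y w.
Proof.
transitivity (\sum_x ((1 - delta x y) * (1 - delta x z)
    - delta x w * ((1 - delta x y) * (1 - delta x z)))).
  by apply: eq_bigr => x _; ring.
rewrite big_split /= sumrN sum_avoid2 sum_delta_mul.
rewrite (deltaC w y) (deltaC w z) /delta.
case: (y =P z) => [->|yz]; case: (z =P w) => [zw|_] //=; try by ring.
by case: (y =P w) => [yw|_] /=; [case: yz; rewrite yw zw | ring].
Qed.

(* Here y, z, w, x are the colors of the vertices 1, 2, 3, 0. *)
Definition count_K4 a b c : int :=
  \sum_y \sum_z \sum_w \sum_x
    (1 - delta x y) * (1 - delta x z) * (1 - delta x w) *
    ((1 - delta z (a y)) * (1 - delta w (b z)) * (1 - delta w (c y))).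

(** The defect of the pair (p, q) is [m - agree p q]. *)
Definition agree p q : int := \sum_y delta (p y) (q y).

Lemma sum_perm_delta p y : \sum_z delta (p z) y = 1.
Proof.
rewrite -(sum_delta (p^-1%g y)); apply: eq_bigr => z _.
by rewrite /delta -(inj_eq (@perm_inj _ p) z) permKV.
Qed.

(** The first three summands count the colorings of the triangle 1, 2, 3 in which the ends of 12,
    23, 13 respectively share the color y; the last corrects for all three having color y. *)
Definition K4_term a b c y : int :=
  (1 - delta (a y) y) * (m - 2 + delta (b y) (c y)) +
  (1 - delta (b y) y) * (m - 2 + delta ((a^-1)%g y) ((c^-1)%g y)) +
  (1 - delta (c y) y) * (m - 2 + delta (a y) ((b^-1)%g y)) -
  (1 - delta (a y) y) * (1 - delta (b y) y) * (1 - delta (c y) y).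

Lemma delta_perm p x y : delta x (p y) = delta y ((p^-1)%g x).
Proof. by rewrite /delta -(inj_eq (@perm_inj _ p) y) permKV eq_sym. Qed.

(** Summing out x by [sum_avoid3] leaves sums over the colorings of the triangle: all of them
    ([E1]), those with one prescribed coincidence ([E2] to [E4]), and those with y = z = w
    ([E5]). *)
Lemma count_K4E a b c :
  count_K4 a b c =
    (m - 3) * (m * (m ^+ 2 - 3 * m + 3) - agree (a * b) c) +
    \sum_y K4_term a b c y.
Proof.
pose A y z : int := 1 - delta z (a y).
pose B z w : int := 1 - delta w (b z).
pose C y w : int := 1 - delta w (c y).
have E1 : \sum_y \sum_z \sum_w A y z * B z w * C y w =
    m * (m ^+ 2 - 3 * m + 3) - agree (a * b) c.
  transitivity (\sum_y (m ^+ 2 - 3 * m + 3 - delta ((a * b)%g y) (c y))); last first.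
    by rewrite big_split /= sumrN sum_const_card.
  apply: eq_bigr => y _.
  transitivity (\sum_z (m - 2 + delta (b z) (c y)
      - delta z (a y) * (m - 2 + delta (b z) (c y)))).
    apply: eq_bigr => z _.
    under eq_bigr => w _ do rewrite -mulrA.
    by rewrite -mulr_sumr sum_avoid2 /A; ring.
  rewrite sumrB big_split /= sum_delta_mul sum_const_card sum_perm_delta permM.
  ring.
have E2 : \sum_y \sum_z \sum_w delta y z * (A y z * B z w * C y w) =
    \sum_y (1 - delta (a y) y) * (m - 2 + delta (b y) (c y)).
  apply: eq_bigr => y _.
  under eq_bigr => z _ do rewrite -mulr_sumr deltaC.
  rewrite sum_delta_mul.
  under eq_bigr => w _ do rewrite -mulrA.
  by rewrite -mulr_sumr sum_avoid2 /A deltaC.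
have E3 : \sum_y \sum_z \sum_w delta z w * (A y z * B z w * C y w) =
    \sum_z (1 - delta (b z) z) * (m - 2 + delta ((a^-1)%g z) ((c^-1)%g z)).
  (* The free color is now y, so its two conditions are restated as avoiding a^-1 z and c^-1 z. *)
  rewrite exchange_big; apply: eq_bigr => z _.
  under eq_bigr => y _.
    under eq_bigr => w _ do rewrite deltaC.
    rewrite sum_delta_mul mulrAC mulrC /A /C.
    rewrite [delta z (a y)]delta_perm [delta z (c y)]delta_perm.
    over.
  by rewrite -mulr_sumr sum_avoid2 /B deltaC.
have E4 : \sum_y \sum_z \sum_w delta y w * (A y z * B z w * C y w) =
    \sum_y (1 - delta (c y) y) * (m - 2 + delta (a y) ((b^-1)%g y)).
  apply: eq_bigr => y _.
  under eq_bigr => z _.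
    under eq_bigr => w _ do rewrite deltaC.
    rewrite sum_delta_mul mulrC /A /B [delta y (b z)]delta_perm.
    over.
  by rewrite -mulr_sumr sum_avoid2 /C deltaC.
have E5 : \sum_y \sum_z \sum_w delta y z * delta y w * (A y z * B z w * C y w) =
    \sum_y (1 - delta (a y) y) * (1 - delta (b y) y) * (1 - delta (c y) y).
  apply: eq_bigr => y _.
  under eq_bigr => z _.
    under eq_bigr => w _ do rewrite -mulrA.
    rewrite -mulr_sumr deltaC.
    under eq_bigr => w _ do rewrite deltaC.
    rewrite sum_delta_mul.
    over.
  by rewrite sum_delta_mul /A /B /C !(deltaC y).
rewrite /count_K4 -E1 /K4_term sumrB !big_split /= -E2 -E3 -E4 -E5.
rewrite mulr_sumr -!big_split -sumrB -big_split; apply: eq_bigr => y _ /=.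
rewrite mulr_sumr -!big_split -sumrB -big_split; apply: eq_bigr => z _ /=.
rewrite mulr_sumr -!big_split -sumrB -big_split; apply: eq_bigr => w _ /=.
rewrite -mulr_suml sum_avoid3 /A /B /C; ring.
Qed.

Lemma agree_ge0 p q : 0 <= agree p q.
Proof. by apply: sumr_ge0 => y _; rewrite /delta; case: eqP. Qed.

Lemma agreeE p q : agree p q = m - #|[set y | p y != q y]|%:Z.
Proof.
rewrite -sum1_card -natz natr_sum big_mkcond /= -[m]mulr1 -sum_const_card -sumrB.
by apply: eq_bigr => y _; rewrite inE /delta; case: eqP.
Qed.

(** Permutations cannot differ at exactly one point: if p y <> q y, they also differ where q takes
    the value p y. *)
Lemma agree_neq p q : p != q -> agree p q <= m - 2.
Proof.
move=> pq; rewrite agreeE; suff: (2 <= #|[set y | p y != q y]|)%N by lia.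
have [y py] : exists y, p y != q y.
  apply/existsP; apply: contraR pq => /existsPn pq; apply/eqP/permP => y.
  exact/eqP/negPn.
pose z := (q^-1 (p y))%g.
have qz : q z = p y by rewrite /z permKV.
have zy : z != y by apply: contraNneq py => zy; rewrite -qz zy.
have pz : p z != q z by rewrite qz (inj_eq perm_inj).
rewrite -(_ : #|[set y; z]| = 2)%N; last by rewrite cards2 eq_sym zy.
by apply: subset_leq_card; apply/subsetP => x /set2P[] ->; rewrite inE.
Qed.

Lemma agree_eq p : agree p p = m.
Proof.
rewrite agreeE (_ : [set _ | _] = set0) ?cards0 ?subr0 //.
by apply/setP => y; rewrite !inE eqxx.
Qed.

(* The points moved by p^2 form a p-stable set on which p has no orbit of
   length 1 or 2. *)
Lemma agree_inv_neq p : p != (p^-1)%g -> agree p (p^-1)%g <= m - 3.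
Proof.
move=> pV; rewrite agreeE; suff: (3 <= #|[set y | p y != (p^-1)%g y]|)%N by lia.
have pVE y : (p y == (p^-1)%g y) = (p (p y) == y).
  by rewrite -(inj_eq (@perm_inj _ p)) permKV.
have [y py] : exists y, p y != (p^-1)%g y.
  apply/existsP; apply: contraR pV => /existsPn pq; apply/eqP/permP => y.
  exact/eqP/negPn.
have ppy : p (p y) != y by rewrite -pVE.
have npy : p y != y by apply: contraNneq ppy => e; rewrite !e.
rewrite -(_ : #|[set y; p y; p (p y)]| = 3)%N.
  apply: subset_leq_card; apply/subsetP => x.
  by rewrite !inE pVE => /orP[/orP[]|] /eqP ->; rewrite ?(inj_eq perm_inj).
rewrite -setUA cardsU1 cards2 !inE negb_or !(eq_sym y) npy ppy.
by rewrite (inj_eq perm_inj) eq_sym npy.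
Qed.

(** Without a fixed point every orbit would have order 2. *)
Lemma involution_odd_fixed p : p = (p^-1)%g -> odd #|T| -> exists y, p y = y.
Proof.
move=> pV; have ppK y : p (p y) = y by rewrite {1}pV permK.
move=> oddT; suff [y /eqP] : exists y, p y == y by exists y.
apply/existsP; apply: contraTT oddT.
move=> /existsPn nfix.
rewrite -(@fcard_order_set _ p (@perm_inj _ p) 2 T) ?oddM ?andbF //.
apply/subsetP => y _; rewrite inE (@order_cycle _ _ [:: y; p y]) //=.
- by rewrite ppK !eqxx.
- by rewrite inE eq_sym nfix.
- by rewrite inE eqxx.
Qed.

(** The bound holds pointwise, with equality if a, b, c all move y. Otherwise the final -1 is saved,
    but a summand of at least m - 2 >= 1 is lost. *)
Lemma sum_K4_term_le a b c : 3 <= m ->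
  \sum_y K4_term a b c y <=
    m * (3 * m - 7) + agree b c + agree (a^-1)%g (c^-1)%g + agree a (b^-1)%g.
Proof.
move=> m3; rewrite -sum_const_card /agree -!big_split; apply: ler_sum => y _ /=.
rewrite /K4_term /delta.
by case: (a y == y); case: (b y == y); case: (c y == y);
  case: (_ == _); case: (_ == _); case: (_ == _) => /=; lia.
Qed.

Lemma agree_le p q : agree p q <= m.
Proof. by have [->|/agree_neq] := eqVneq p q; rewrite ?agree_eq //; lia. Qed.

Lemma count_K4_le a b c : 3 <= m ->
  count_K4 a b c <= m ^+ 4 - 6 * m ^+ 3 + 15 * m ^+ 2 - 13 * m
    + (agree b c - m) + (agree (a^-1)%g (c^-1)%g - m) + (agree a (b^-1)%g - m).
Proof.
move=> m3; rewrite count_K4E.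
have S := sum_K4_term_le a b c m3.
have m3' : 0 <= m - 3 by lia.
(* The contribution of [agree (a * b) c] is nonpositive and is dropped. *)
have := mulr_ge0 m3' (agree_ge0 (a * b) c).
nra.
Qed.

(** The fixed point contributes 0 and every other point at most 3 (m - 1) - 1 = 3 m - 4, so at least
    5 is lost. *)
Lemma count_involution_le a y : 3 <= m -> a = (a^-1)%g -> a y = y ->
  count_K4 a a a <= m ^+ 4 - 6 * m ^+ 3 + 15 * m ^+ 2 - 13 * m - 3.
Proof.
move=> m3 aV ay; rewrite count_K4E (bigD1 y) //=.
have S : \sum_(x | x != y) K4_term a a a x <= (m - 1) * (3 * m - 4).
  have -> : m - 1 = \sum_(x | x != y) 1.
    by rewrite sumr_const cardC1 natz; lia.
  rewrite mulr_suml; apply: ler_sum => x _; rewrite mul1r /K4_term -aV.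
  by rewrite /delta eqxx; case: (_ == _) => /=; lia.
have -> : K4_term a a a y = 0 by rewrite /K4_term ay /delta eqxx /=; ring.
have m3' : 0 <= m - 3 by lia.
have := mulr_ge0 m3' (agree_ge0 (a * a) a).
nra.
Qed.

Lemma count_K4_le_odd a b c : 3 <= m -> odd #|T| ->
  count_K4 a b c <= m ^+ 4 - 6 * m ^+ 3 + 15 * m ^+ 2 - 13 * m - 3.
Proof.
move=> m3 oddT.
have H := count_K4_le a b c m3.
have L1 := agree_le b c; have L2 := agree_le (a^-1)%g (c^-1)%g.
have L3 := agree_le a (b^-1)%g.
(* Two nonzero defects cost at least 4, which [lia] settles; what remains is no nonzero defect or
   exactly one. *)
have [e1|/agree_neq N1] := eqVneq b c; have [e3|/agree_neq N3] := eqVneq a (b^-1)%g;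
  have [e2|/agree_neq N2] := eqVneq (a^-1)%g (c^-1)%g; try lia.
- have aV : a = (a^-1)%g by rewrite {1}e3 e1 e2.
  have [y ay] := involution_odd_fixed aV oddT.
  have eb : b = a by rewrite e1; apply: invg_inj.
  by rewrite -e1 eb; exact: count_involution_le ay.
(* In this case and the next two, the equalities turn the nonzero defect into that of (b, b^-1): it
   is at least 3, since b = b^-1 would make it vanish. *)
- move: N2 H; rewrite e3 -e1 invgK.
  by have [<-|/agree_inv_neq] := eqVneq b (b^-1)%g; rewrite ?agree_eq; lia.
- move: N3 H; rewrite (invg_inj e2) -e1.
  by have [<-|/agree_inv_neq] := eqVneq b (b^-1)%g; rewrite ?agree_eq; lia.
- move: N1 H; rewrite -(invg_inj e2) e3.
  by have [<-|/agree_inv_neq] := eqVneq b (b^-1)%g; rewrite ?agree_eq; lia.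
Qed.

(** Only the conditions at vertex 0 are kept: x is free and each of y, z, w avoids it. *)
Lemma count_K4_le_greedy a b c : count_K4 a b c <= m * (m - 1) ^+ 3.
Proof.
have S x : \sum_y (1 - delta x y) = m - 1.
  under eq_bigr do rewrite deltaC.
  by rewrite sumrB sum_delta sum_const_card mulr1.
have -> : m * (m - 1) ^+ 3 = \sum_(x : T) \sum_y \sum_z \sum_w
    (1 - delta x y) * (1 - delta x z) * (1 - delta x w).
  rewrite -sum_const_card; apply: eq_bigr => x _.
  rewrite exprSr expr2 -{1}(S x) !mulr_suml; apply: eq_bigr => y _.
  rewrite -mulrA -{1}(S x) mulr_suml mulr_sumr; apply: eq_bigr => z _.
  by rewrite -mulr_sumr S mulrA.
rewrite [leRHS]exchange_big; apply: ler_sum => y _ /=.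
rewrite [leRHS]exchange_big; apply: ler_sum => z _ /=.
rewrite [leRHS]exchange_big; apply: ler_sum => w _ /=.
apply: ler_sum => x _; rewrite /delta.
by do 6! case: (_ == _).
Qed.
End Counting.

(** * The exact count for the extremal triple (a, a^-1, a) *)

Section Count_value.
Variable T : finType.
Variable a : {perm T}.
Let m : int := #|T|%:Z.
Hypothesis nfix : forall y, a y != y.

(** Both estimates behind [count_K4_le] become equalities, as a and a^-1 have no fixed point and
    [agree (a * b) c] counts those of a. The only defect left is that of (a^-1, a), the number of
    points moved by a^2. *)
Lemma count_K4_value :
  count_K4 a (a^-1)%g a =
    m ^+ 4 - 6 * m ^+ 3 + 15 * m ^+ 2 - 13 * m - #|[set y | a (a y) != y]|%:Z.
Proof.
have nfV y : (a^-1)%g y != y by rewrite -(inj_eq (@perm_inj _ a)) permKV eq_sym.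
rewrite count_K4E mulgV.
rewrite (_ : agree 1 a = 0); last first.
  by apply: big1 => y _; rewrite perm1 /delta eq_sym (negbTE (nfix y)).
transitivity ((m - 3) * (m * (m ^+ 2 - 3 * m + 3) - 0) +
    (\sum_(y : T) (3 * m - 5) + agree (a^-1)%g a)).
  rewrite /agree -big_split; congr (_ + _); apply: eq_bigr => y _ /=.
  rewrite /K4_term /delta invgK (negbTE (nfix y)) (negbTE (nfV y)) !eqxx -/m /=.
  ring.
rewrite sum_const_card agreeE -/m.
rewrite (_ : [set y | a (a y) != y] = [set y | (a^-1)%g y != a y]).
  by ring.
by apply/setP => y; rewrite !inE -[in RHS](inj_eq (@perm_inj _ a)) permKV eq_sym.
Qed.
End Count_value.

(* [finset.cover] shadows the name. *)
Local Notation cover := Defs.cover.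

(** * Full covers in coordinates *)

Section Covers.
Variables (G : sgraph) (C : cover G).
Implicit Types (u v : G) (x y : cgraph C).

Lemma clist_inj : injective (clist C).
Proof.
move/eqP: (clist_card C) => /imset_injP inj u v e; exact: inj.
Qed.

Lemma clist_disjoint u v x : x \in clist C u -> x \in clist C v -> u = v.
Proof.
move=> xu xv; apply/eqP; apply: contraTT xv => uv.
have /and3P[_ /trivIsetP tI _] := clist_partition C.
have /(_ (clist C u) (clist C v)) := tI.
rewrite !imset_f // (inj_eq clist_inj) => /(_ isT isT uv) d.
by rewrite (disjointFr d xu).
Qed.

Lemma clist_cover x : exists v, x \in clist C v.
Proof.
have /and3P[/eqP cov _ _] := clist_partition C.
have : x \in finset.cover [set clist C v | v : G] by rewrite cov inE.
by case/bigcupP => _ /imsetP[v _ ->]; exists v.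
Qed.

(** Both edges contain x, so in a matching they are the same set; y = x is excluded because there
    are no loops. *)
Lemma cover_edge_uniq u v x y y' : edge u v ->
  x \in clist C u -> y \in clist C v -> y' \in clist C v ->
  edge x y -> edge x y' -> y = y'.
Proof.
move=> uv xu yv y'v xy xy'.
have inE' z : z \in clist C v -> edge x z ->
    [set x; z] \in edges_between (clist C u) (clist C v).
  by move=> zv xz; apply/imset2P; exists x z => //; rewrite inE zv.
have e : [set x; y] = [set x; y'].
  apply/eqP; apply: contraTT isT => ne.
  have /trivIsetP/(_ _ _ (inE' y yv xy) (inE' y' y'v xy') ne) := cover_matching C uv.
  by move=> /disjointFr/(_ (set21 x y)); rewrite set21.
have : y \in [set x; y'] by rewrite -e set22.
by case/set2P => // yx; move: xy; rewrite yx edge_irrefl.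
Qed.

(** Sending each matched vertex of L(u) to its edge reaches all m edges, so all m vertices of L(u)
    are matched. *)
Lemma full_cover_neighbor m u v x : full_cover m C -> edge u v ->
  x \in clist C u -> exists2 y, y \in clist C v & edge x y.
Proof.
move=> [fold full] uv xu.
pose D := [set x in clist C u | [exists y in clist C v, edge x y]].
suff /eqP eD : D == clist C u.
  by move: xu; rewrite -eD inE => /andP[_ /exists_inP].
rewrite eqEcard; apply/andP; split.
  by apply/subsetP => z; rewrite inE => /andP[].
rewrite fold -(full u v uv).
pose nb z := odflt z [pick y in clist C v | edge z y].
apply: leq_trans (leq_imset_card (fun z : cgraph C => [set z; nb z]) (mem D)).
apply: subset_leq_card; apply/subsetP => e /imset2P[z y zu].
rewrite inE => /andP[yv zy] {e}->; apply/imsetP; exists z.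
  by rewrite inE zu; apply/existsP; exists y; rewrite yv.
congr [set _; _]; rewrite /nb; case: pickP => [y' /andP[y'v zy']|/(_ y)] /=.
  exact: cover_edge_uniq uv zu yv y'v zy zy'.
by rewrite yv zy.
Qed.

Section Coordinates.
Variables (m : nat) (e : G -> 'I_m -> cgraph C).
Hypothesis e_inj : forall v, injective (e v).
Hypothesis e_image : forall v, [set e v i | i : 'I_m] = clist C v.

Lemma coord_in v i : e v i \in clist C v.
Proof. by rewrite -e_image imset_f. Qed.

(** Transversals are the sets [F f], and f is recovered from the intersections of [F f] with the
    lists. *)
Lemma PDP_coord :
  PDP C = #|[set f : {ffun G -> 'I_m} |
     [forall u, forall v, ~~ edge (e u (f u)) (e v (f v))]]|.
Proof.
pose F (f : {ffun G -> 'I_m}) := [set e v (f v) | v : G].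
have FI f v : F f :&: clist C v = [set e v (f v)].
  apply/setP => x; rewrite !inE; apply/andP/eqP => [[/imsetP[w _ ->] wv]|->].
    by rewrite (clist_disjoint (coord_in w (f w)) wv).
  by rewrite coord_in imset_f.
have F_inj : injective F.
  move=> f g fg; apply/ffunP => v; apply: (@e_inj v); apply/set1P.
  by rewrite -FI -fg FI set11.
rewrite -(card_imset _ F_inj) /PDP; congr #|pred_of_set _|.
apply/setP => T; rewrite inE; apply/andP/imsetP => [[/forallP trT indT]|[f]].
  have /fin_all_exists[f Pf] v : exists i, T :&: clist C v = [set e v i].
    have /cards1P[x Tx] := trT v.
    have : x \in T :&: clist C v by rewrite Tx set11.
    rewrite inE -e_image => /andP[_ /imsetP[i _ xi]].
    by exists i; rewrite e_image Tx xi.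
  have fT v : e v (f v) \in T.
    by have := set11 (e v (f v)); rewrite -Pf inE => /andP[].
  exists [ffun v => f v]; last first.
    apply/setP => x; apply/idP/imsetP => [xT|[v _ ->]]; last by rewrite ffunE.
    have [v xv] := clist_cover x; exists v => //.
    by rewrite ffunE; apply/set1P; rewrite -Pf inE xT.
  rewrite inE; apply/forallP => u; apply/forallP => v; rewrite !ffunE.
  by have /forall_inP/(_ _ (fT u))/forall_inP/(_ _ (fT v)) := indT.
rewrite inE => /forallP Pf ->; split.
  by apply/forallP => v; rewrite FI cards1.
apply/forall_inP => _ /imsetP[u _ ->]; apply/forall_inP => _ /imsetP[v _ ->].
by have /forallP := Pf u.
Qed.

(** Fullness gives a neighbor in L(v), hence a function; the matching condition read from v makes it
    injective, and read from u makes that neighbor unique. *)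
Lemma coord_perm u v : full_cover m C -> edge u v ->
  exists s : {perm 'I_m}, forall i j, edge (e u i) (e v j) = (j == s i).
Proof.
move=> full uv.
have /fin_all_exists[s Ps] i : exists j, edge (e u i) (e v j).
  have [y] := full_cover_neighbor full uv (coord_in u i).
  by rewrite -e_image => /imsetP[j _ ->]; exists j.
have s_inj : injective s.
  move=> i j ij; apply: (@e_inj u); have vu : edge v u by rewrite edge_sym.
  apply: (cover_edge_uniq vu (coord_in v (s i)) (coord_in u i) (coord_in u j)).
    by rewrite edge_sym.
  by rewrite ij edge_sym.
exists (perm s_inj) => i j; rewrite permE; apply/idP/eqP => [ij|-> //].
apply: (@e_inj v).
exact: (cover_edge_uniq uv (coord_in u i) (coord_in v j) (coord_in v (s i))).
Qed.

End Coordinates.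

Lemma fold_cover_coord m : fold_cover m C ->
  exists e : G -> 'I_m -> cgraph C,
    (forall v, injective (e v)) /\
    (forall v, [set e v i | i : 'I_m] = clist C v).
Proof.
move=> fold.
exists (fun v i => enum_val (cast_ord (esym (fold v)) i)); split=> v.
  by move=> i j /enum_val_inj/cast_ord_inj.
apply/setP => x; apply/imsetP/idP => [[i _ ->]|xv]; first exact: enum_valP.
exists (cast_ord (fold v) (enum_rank_in xv x)) => //.
by rewrite cast_ordK enum_rankK_in.
Qed.

End Covers.

(** * Normal form of full covers of K4 *)

Definition K4_coord (C : cover K4) m (e : 'I_4 -> 'I_m -> cgraph C)
    (a b c : {perm 'I_m}) : Prop :=
  [/\ forall v, injective (e v),
      forall v, [set e v i | i : 'I_m] = clist C v,
      forall (v : 'I_4) i j, v != 0 -> edge (e 0 i) (e v j) = (i == j) &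
      forall i j, [/\ edge (e 1 i) (e 2 j) = (j == a i),
                      edge (e 2 i) (e 3 j) = (j == b i) &
                      edge (e 1 i) (e 3 j) = (j == c i)]].

Lemma full_cover_K4_coord m (C : cover K4) : full_cover m C ->
  exists e a b c, @K4_coord C m e a b c.
Proof.
move=> full; have [e' [inj' im']] := fold_cover_coord full.1.
have /fin_all_exists[s Ps] (v : 'I_4) : exists s : {perm 'I_m},
    v != 0 -> forall i j, edge (e' 0 i) (e' v j) = (j == s i).
  have [->|v0] := eqVneq v 0; first by exists 1%g.
  have [|s Ps] := coord_perm inj' im' full (_ : edge (0 : K4) v).
    by rewrite /edge /= eq_sym.
  by exists s.
(* Relabelling L(v) along the matching from L(0) turns that matching into the identity. *)
pose s0 v := if v == 0 then 1%g else s v.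
pose e v i := e' v (s0 v i).
have inj v : injective (e v) by move=> i j /inj'/perm_inj.
have im v : [set e v i | i : 'I_m] = clist C v.
  rewrite -im'; apply/setP => x; apply/imsetP/imsetP => -[i _ ->].
    by exists (s0 v i).
  by exists ((s0 v)^-1%g i) => //; rewrite /e permKV.
have [//|a Pa] := coord_perm inj im full (_ : edge (1 : K4) 2).
have [//|b Pb] := coord_perm inj im full (_ : edge (2 : K4) 3).
have [//|c Pc] := coord_perm inj im full (_ : edge (1 : K4) 3).
exists e, a, b, c; split => // v i j v0.
by rewrite /e /s0 eqxx (negbTE v0) perm1 Ps // (inj_eq perm_inj) eq_sym.
Qed.

Lemma forall_ord4 (P : pred 'I_4) :
  [forall v, P v] = [&& P 0, P 1, P 2 & P 3].
Proof.
apply/forallP/and4P => [H|[P0 P1 P2 P3] v]; first by split.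
by case: v => -[|[|[|[|]]]] //= i; [move: P0|move: P1|move: P2|move: P3];
  congr (is_true (P _)); apply: val_inj.
Qed.

Lemma PDP_K4 m (C : cover K4) e a b c :
  @K4_coord C m e a b c -> (PDP C)%:Z = count_K4 a b c.
Proof.
move=> [inj im P0 Ps]; rewrite (@PDP_coord K4 C m e inj im) /count_K4 !pair_bigA /=.
(* The quadruple is (y, z, w, x), in the order of the sums in [count_K4]; vertex 0 takes the last
   entry. *)
pose q2f (q : 'I_m * 'I_m * 'I_m * 'I_m) : {ffun K4 -> 'I_m} :=
  [ffun v : 'I_4 => nth q.2 [:: q.2; q.1.1.1; q.1.1.2; q.1.2] v].
pose f2q (f : {ffun K4 -> 'I_m}) : 'I_m * 'I_m * 'I_m * 'I_m :=
  (f (1 : 'I_4), f (2 : 'I_4), f (3 : 'I_4), f (0 : 'I_4)).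
have q2fK : cancel q2f f2q by move=> [[[y z] w] x]; rewrite /f2q !ffunE.
have f2qK : cancel f2q q2f.
  move=> f; apply/ffunP => v; apply/eqP; move: v; apply/forallP.
  by rewrite forall_ord4 !ffunE /= !eqxx.
rewrite -sum1_card -natz natr_sum big_mkcond /= (reindex q2f) /=; last first.
  by exists f2q => ? _; [exact: q2fK | exact: f2qK].
apply: eq_bigr => -[[[y z] w] x] _ /=.
rewrite inE !forall_ord4 !ffunE /= !edge_irrefl.
(* Each pair of vertices occurs in both orders; all are oriented from the smaller to the larger
   one. *)
rewrite !(edge_sym (e 3 _)) !(edge_sym (e 2 _) (e 1 _)) !(edge_sym _ (e 0 _)).
rewrite !P0 //.
have [-> _ _] := Ps y z; have [_ -> _] := Ps z w; have [_ _ ->] := Ps y w.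
rewrite /delta.
by do 6! case: (_ == _).
Qed.

(** * Covers built from a permutation on each edge *)

Section PermCover.
Variables (G : sgraph) (n : nat).
Let m := n.+1.
Variable s : G -> G -> {perm 'I_m}.
Hypothesis s_inv : forall u v, s v u = ((s u v)^-1)%g.

Definition perm_edge : rel (G * 'I_m) :=
  fun x y => edge x.1 y.1 && (y.2 == s x.1 y.1 x.2).

Lemma perm_edge_sym : symmetric perm_edge.
Proof.
move=> x y; rewrite /perm_edge edge_sym (s_inv x.1 y.1); congr (_ && _).
by rewrite -(inj_eq (@perm_inj _ (s x.1 y.1)) x.2) permKV eq_sym.
Qed.

Lemma perm_edge_irrefl : irreflexive perm_edge.
Proof. by move=> x; rewrite /perm_edge edge_irrefl. Qed.

Definition perm_graph : sgraph :=
  SGraph perm_edge_sym perm_edge_irrefl (prod_gt0 G n).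

(** [perm_graph] has the vertices of [prod_graph], so the partition facts of the product cover carry
    over. *)
Definition perm_list (v : G) : {set perm_graph} := @prod_list G n v.

Lemma in_perm_list v (x : perm_graph) : (x \in perm_list v) = (x.1 == v).
Proof. exact: in_prod_list. Qed.

Lemma perm_between u v : edge u v ->
  edges_between (perm_list u) (perm_list v) =
  [set [set ((u, i) : perm_graph); ((v, s u v i) : perm_graph)] | i : 'I_m].
Proof.
move=> uv; apply/setP => x; apply/imset2P/imsetP.
- move=> [[x1 x2] [y1 y2]]; rewrite in_perm_list => /eqP /= ->.
  rewrite inE in_perm_list /= => /andP[/eqP -> /andP[_ /eqP /= ->]] ->.
  by exists x2.
- move=> [i _ ->].
  exists ((u, i) : perm_graph) ((v, s u v i) : perm_graph) => //.
    by rewrite in_perm_list.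
  by rewrite inE in_perm_list /= eqxx /edge /= /perm_edge /= uv eqxx.
Qed.

Lemma perm_mem_between u v i j (x : perm_graph) : edge u v ->
  x \in [set ((u, i) : perm_graph); ((v, s u v i) : perm_graph)] ->
  x \in [set ((u, j) : perm_graph); ((v, s u v j) : perm_graph)] -> i = j.
Proof.
move=> uv; have ne : u <> v by move=> e; rewrite e edge_irrefl in uv.
move=> /set2P[] -> /set2P[] [] //; first by move=> e; case: ne.
exact: perm_inj.
Qed.

Lemma perm_matching u v : edge u v ->
  matching (edges_between (perm_list u) (perm_list v)).
Proof.
move=> uv; rewrite perm_between //.
apply/trivIsetP => _ _ /imsetP[i _ ->] /imsetP[j _ ->] ij.
rewrite -setI_eq0; apply/eqP/setP => x; rewrite in_setI in_set0.
apply/negbTE/negP => /andP[xi xj].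
by move: ij; rewrite (perm_mem_between uv xi xj) eqxx.
Qed.

Lemma perm_edges : edges perm_graph =
  (\bigcup_(uv : G * G | edge uv.1 uv.2)
     edges_between (perm_list uv.1) (perm_list uv.2)).
Proof.
apply/setP => e; apply/imset2P/bigcupP.
- move=> [x y _]; rewrite !inE => /= xy ->.
  exists (x.1, y.1); first by case/andP: xy.
  apply/imset2P; exists x y => //; first by rewrite in_perm_list.
  by rewrite inE in_perm_list eqxx.
- move=> [[u v] /= uv] /imset2P[x y _]; rewrite inE => /andP[_ xy] ->.
  by exists x y => //; rewrite !inE.
Qed.

Definition perm_cover : cover G :=
  Cover (prod_partition G n : partition [set perm_list v | v : G] [set: perm_graph])
    (prod_card G n) perm_matching perm_edges.

Lemma perm_list_image v :
  [set ((v, i) : perm_graph) | i : 'I_m] = clist perm_cover v.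
Proof.
apply/setP => -[w i]; rewrite in_perm_list /=; apply/imsetP/eqP.
  by move=> [j _ []].
by move=> ->; exists i.
Qed.

Lemma perm_cover_full : full_cover m perm_cover.
Proof.
split=> [v | u v uv] /=.
  by rewrite -[perm_list v]perm_list_image card_imset ?card_ord // => i j [].
rewrite perm_between // card_imset ?card_ord // => i j eij.
by apply: (@perm_mem_between u v i j ((u, i) : perm_graph));
  rewrite -?eij ?set21.
Qed.
End PermCover.

Lemma exists_cover_K4 n (a b c : {perm 'I_n.+1}) :
  exists2 C : cover K4, full_cover n.+1 C & (PDP C)%:Z = count_K4 a b c.
Proof.
(* The default 1 puts the identity on the three edges at vertex 0. *)
pose s (u v : K4) : {perm 'I_n.+1} :=
  match val u, val v with
  | 1, 2 => a | 2, 1 => a^-1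
  | 2, 3 => b | 3, 2 => b^-1
  | 1, 3 => c | 3, 1 => c^-1
  | _, _ => 1
  end%g%N.
have s_inv u v : s v u = ((s u v)^-1)%g.
  rewrite /s; case: u v => [[|[|[|[|]]]]] //= _ [[|[|[|[|]]]]] //= _.
  all: rewrite ?invg1 ?invgK //.
exists (perm_cover s_inv); first exact: perm_cover_full.
apply: (@PDP_K4 n.+1 (perm_cover s_inv) (fun v i => (v, i) : perm_graph s_inv)); split.
- by move=> v i j [].
- exact: (perm_list_image s_inv).
- move=> v i j v0; rewrite /edge /= /perm_edge /= eq_sym v0 /=.
  by rewrite /s /= perm1 eq_sym.
- by [].
Qed.

(** * Extremal permutations, given by arithmetic on indices *)

Lemma perm_of_nat n (f : nat -> nat) :
  (forall i, i < n -> f i < n)%N ->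
  (forall i j, i < n -> j < n -> f i = f j -> i = j)%N ->
  exists a : {perm 'I_n}, forall i, a i = f i :> nat.
Proof.
move=> fn finj; pose g (i : 'I_n) := Ordinal (fn i (ltn_ord i)).
have g_inj : injective g.
  by move=> i j [] /finj e; apply: val_inj; apply: e.
by exists (perm g_inj) => i; rewrite permE.
Qed.

(* The product of the transpositions (0 1), (2 3), ... *)
Lemma exists_involution n : ~~ odd n ->
  exists2 a : {perm 'I_n}, forall y, a y != y &
    #|[set y | a (a y) != y]| = 0%N.
Proof.
move=> evn; pose f i := if odd i then i.-1 else i.+1.
have [||a aE] := @perm_of_nat n f; rewrite ?/f.
- by move=> i; case: ifP => oi; lia.
- by move=> i j _ _; case: ifP => oi; case: ifP => oj; lia.
exists a => [y|].
  by rewrite -val_eqE /= aE /f; case: ifP => oy; lia.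
apply/eqP; rewrite cards_eq0; apply/eqP/setP => y; rewrite !inE.
apply/negbTE/negPn; rewrite -val_eqE /= !aE /f.
by case oy: (odd y); case: ifP => oy'; lia.
Qed.

(* The product of the 3-cycle (0 1 2) and the transpositions (3 4), (5 6), ... *)
Lemma exists_near_involution n : odd n -> (3 <= n)%N ->
  exists2 a : {perm 'I_n}, forall y, a y != y &
    #|[set y | a (a y) != y]| = 3%N.
Proof.
move=> oddn n3.
pose f i := if (i < 2)%N then i.+1 else if i == 2%N then 0%N
  else if odd i then i.+1 else i.-1.
have fP i : [\/ (i < 2)%N /\ f i = i.+1, i = 2 /\ f i = 0%N,
    (2 < i)%N /\ odd i /\ f i = i.+1 | (2 < i)%N /\ ~~ odd i /\ f i = i.-1].
  rewrite /f; do ?case: ifP => ?; first [by apply: Or41; lia | by apply: Or42; lia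
    | by apply: Or43; lia | by apply: Or44; lia].
have [||a aE] := @perm_of_nat n f.
- by move=> i; case: (fP i) => -[]; lia.
- by move=> i j _ _; case: (fP i) => -[] ? ?; case: (fP j) => -[]; lia.
exists a => [y|].
  by rewrite -val_eqE /= aE; case: (fP y) => -[]; lia.
have w_inj : injective (widen_ord n3) by move=> i j [/val_inj].
rewrite -[RHS](card_ord 3) -[RHS](card_imset _ w_inj).
congr #|pred_of_set _|; apply/setP => y; rewrite inE -val_eqE /= !aE.
have -> : (f (f y) != y) = (y < 3)%N.
  case: (fP y) => -[] ? ?; case: (fP (f y)) => -[] ? ?; apply/idP/idP; lia.
apply/idP/imsetP => [y3|[i _ ->]]; last exact: (ltn_ord i).
by exists (Ordinal y3) => //; apply: val_inj.
Qed.

(** * The value of the dual DP color function of K4 *)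

Lemma dual_PDP_K4 m : (2 <= m)%N ->
  (dual_PDP K4 m)%:Z = m%:Z ^+ 4 - 6 * m%:Z ^+ 3 + 15 * m%:Z ^+ 2 - 13 * m%:Z
    - (if odd m then 3 else 0).
Proof.
move=> m2; have m0 : (0 < m)%N by lia.
have [[C Cfull <-] maxC] := dual_PDPP K4 m0.
apply/eqP; rewrite eq_le; apply/andP; split.
  have [e [a [b [c /PDP_K4 ->]]]] := full_cover_K4_coord Cfull.
  have [m2'|m3] : (m = 2 \/ 3 <= m)%N by lia.
    (* At m = 2 the greedy bound and the claimed value are both 2. *)
    have := @count_K4_le_greedy _ a b c; rewrite card_ord => H.
    by apply: le_trans H _; rewrite {}m2'.
  have m3' : 3 <= #|'I_m|%:Z by rewrite card_ord; lia.
  case: ifP => om.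
    by have := @count_K4_le_odd _ a b c m3'; rewrite card_ord => /(_ om).
  have := @count_K4_le _ a b c m3'.
  have := @agree_le _ b c; have := @agree_le _ a (b^-1)%g.
  have := @agree_le _ (a^-1)%g (c^-1)%g; rewrite card_ord; lia.
have [a nfix ca] : exists2 a : {perm 'I_m}, forall y, a y != y &
    #|[set y | a (a y) != y]| = (if odd m then 3 else 0)%N.
  case: ifP => om; last by apply: exists_involution; rewrite om.
  by apply: exists_near_involution => //; case: m om m2 {m0 Cfull maxC C} => [|[|[]]].
case: m m2 m0 C Cfull maxC a nfix ca => // n _ _ C Cfull maxC a nfix ca.
have [C' C'full PC'] := exists_cover_K4 a (a^-1)%g a.
have := maxC C' C'full; rewrite -lez_nat PC' count_K4_value // ca card_ord.
by case: (odd _).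
Qed.

(** * Non-polynomiality *)

(** A nonzero p - q would have as many distinct roots as its size; the numbers k i stay distinct in
    R, a domain of characteristic 0. *)
Lemma poly_eq_infinitely_often (R : numDomainType) (p q : {poly R}) (k : nat -> nat) :
  injective k -> (forall i, p.[(k i)%:R] = q.[(k i)%:R]) -> p = q.
Proof.
move=> k_inj pq; apply/eqP; rewrite -subr_eq0; apply/negPn/negP => nz.
pose s := [seq (k i)%:R : R | i <- iota 0 (size (p - q))].
have : (size s < size (p - q)%R)%N.
  apply: max_poly_roots nz _ _.
    by apply/allP => _ /mapP[i _ ->]; rewrite rootE hornerD hornerN pq subrr.
  rewrite map_inj_uniq ?iota_uniq // => i j /eqP.
  by rewrite eqr_nat => /eqP /k_inj.
by rewrite size_map size_iota ltnn.
Qed.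

Theorem theorem3 :
  (forall m : nat, (2 <= m)%N ->
     (dual_PDP K4 m)%:Z =
       if ~~ odd m
       then m%:Z ^+ 4 - 6 * m%:Z ^+ 3 + 15 * m%:Z ^+ 2 - 13 * m%:Z
       else m%:Z ^+ 4 - 6 * m%:Z ^+ 3 + 15 * m%:Z ^+ 2 - 13 * m%:Z - 3)
  /\
  (forall R : numDomainType,
     ~ exists (N : nat) (p : {poly R}),
         (1 <= N)%N /\
         forall m : nat, (N <= m)%N -> (dual_PDP K4 m)%:R = p.[m%:R]).
Proof.
split=> [m m2|R [N [p [_ pE]]]].
  by rewrite dual_PDP_K4 //; case: (odd m); rewrite ?subr0.
pose q : {poly R} := 'X^4 - 6 *: 'X^3 + 15 *: 'X^2 - 13 *: 'X.
have valE m : (2 <= m)%N -> (N <= m)%N ->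
    p.[m%:R] = q.[m%:R] - (if odd m then 3 else 0).
  (* The integer formula is carried to R by the canonical morphism. *)
  move=> m2 Nm; rewrite -pE // -[_%:R]/((dual_PDP K4 m)%:Z%:~R) dual_PDP_K4 //.
  rewrite /q !(hornerD, hornerN, hornerZ, hornerXn, hornerX).
  rewrite !(rmorphD, rmorphN, rmorphM, rmorphXn) /=.
  by case: (odd m).
(* The sample points are even and at least max(2, N), where no correction by 3 occurs. *)
have pq : p = q.
  apply: (@poly_eq_infinitely_often _ _ _ (fun i => (i + N).*2.+2)) => [i j|i].
    by lia.
  by rewrite valE ?subr0 /= ?odd_double ?subr0 //; lia.
(* At the odd number 2 N + 3, p = q would force 3 = 0 in R. *)
have /eqP : p.[(N.*2.+3)%:R] = q.[(N.*2.+3)%:R] - 3.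
  by rewrite valE /= ?odd_double //; lia.
by rewrite pq -subr_eq0 opprB addrC subrK pnatr_eq0.
Qed.
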